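(* Let $(W,S)$ be a finitely generated Coxeter system, ordered by the partial order $\le$ defined in the context. (1) The poset $(W,\le)$ is graded with rank function $w\mapsto |S(w)|$; that is, $e$ is the unique minimal element, $|S(e)|=0$, and whenever $v$ covers $u$ in $(W,\le)$ one has $|S(v)|=|S(u)|+1$. (2) For any $u\le v$ in $W$, the interval $[u,v]=\{w\in W: u\le w\le v\}$ is an upper semimodular lattice.
   Context: $(W,S)$ is a finitely generated Coxeter system with length function $\ell$ and identity $e$. For $w\in W$, $S(w)\subseteq S$ is the set of simple reflections appearing in a (any) reduced expression of $w$ (this does not depend on the reduced expression); the connectivity set is $C(w)=S\setminus S(w)$. The descent set is $\mathrm{Des}(w)=\{s\in S:\ell(ws)<\ell(w)\}$. For $I\subseteq S$, $W_I$ is the parabolic subgroup generated by $I$, and $X_I=\{u\in W:\ell(us)>\ell(u)\ \forall s\in I\}$ is the set of minimal length coset representatives of $W/W_I$; every $w\in W$ has a unique factorization $w=w^Iw_I$ with $w^I\in X_I$, $w_I\in W_I$ (the parabolic components of $w$ along $I$), and $\ell(w)=\ell(w^I)+\ell(w_I)$. The partial order on $W$: $u\le v$ if and only if $v_{S(u)}=u$. A cover of $u$ is an element $v>u$ with $[u,v]=\{u,v\}$. A lattice $L$ is upper semimodular if whenever $g,h\in L$ both cover $w\in L$, there is $x\in L$ covering both $g$ and $h$. *)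

(* Defs.v *)
From HB Require Import structures.
From mathcomp Require Import all_boot.
From mathcomp Require Import boolp.

Set Implicit Arguments.
Unset Strict Implicit.
Unset Printing Implicit Defensive.

Local Open Scope group_scope.

Definition prodw (W : groupType) (I : Type) (gen : I -> W) (s : seq I) : W :=
  foldr (fun i x => gen i * x) 1 s.

(* Coxeter matrix on the finite index set I; m i j = 0 encodes m_ij = infinity. *)
Definition coxeter_matrix (I : finType) (m : I -> I -> nat) : Prop :=
  forall i j, m i j = m j i /\ (i = j -> m i j = 1%N) /\ (i <> j -> m i j <> 1%N).

Definition coxeter_relations (G : groupType) (I : finType) (f : I -> G)
    (m : I -> I -> nat) : Prop :=
  forall i j, m i j <> 0%N -> (f i * f j) ^+ (m i j) = 1.

(* (W, S) with S = {gen i | i in I} is a (finitely generated) Coxeter system: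
   W is presented by generators S and the Coxeter relations of m. *)
Definition coxeter_system (W : groupType) (I : finType) (gen : I -> W)
    (m : I -> I -> nat) : Prop :=
  [/\ coxeter_matrix m,
      coxeter_relations gen m,
      (* S generates W (as the generators are involutions, words suffice) *)
      (forall w : W, exists s : seq I, w = prodw gen s) &
      (forall (G : groupType) (f : I -> G), coxeter_relations f m ->
         exists phi : W -> G,
           (forall x y, phi (x * y) = phi x * phi y) /\
           (forall i, phi (gen i) = f i))].

Definition reduced (W : groupType) (I : Type) (gen : I -> W) (w : W)
    (s : seq I) : Prop :=
  prodw gen s = w /\ forall t : seq I, prodw gen t = w -> (size s <= size t)%N.

Definition supp (W : groupType) (I : finType) (gen : I -> W) (w : W) : {set I} :=
  [set i | `[< exists s : seq I, reduced gen w s /\ i \in s >]].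

Definition in_parabolic (W : groupType) (I : finType) (gen : I -> W)
    (J : {set I}) (w : W) : Prop :=
  exists s : seq I, all (fun i => i \in J) s /\ w = prodw gen s.

Definition in_X (W : groupType) (I : finType) (gen : I -> W)
    (J : {set I}) (u : W) : Prop :=
  forall i, i \in J -> forall a b : seq I,
    reduced gen u a -> reduced gen (u * gen i) b -> (size a < size b)%N.

Definition parabolic_factorization (W : groupType) (I : finType) (gen : I -> W)
    (J : {set I}) (w x y : W) : Prop :=
  [/\ in_X gen J x, in_parabolic gen J y & w = x * y].

(* u <= v  iff  v_{S(u)} = u *)
Definition cox_le (W : groupType) (I : finType) (gen : I -> W) (u v : W) : Prop :=
  exists x : W, parabolic_factorization gen (supp gen u) v x u.

Definition covers_in (T : Type) (le : T -> T -> Prop) (P : T -> Prop)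
    (a b : T) : Prop :=
  [/\ P a, P b, le a b, a <> b &
      forall c, P c -> le a c -> le c b -> c = a \/ c = b].

Definition covers (T : Type) (le : T -> T -> Prop) (a b : T) : Prop :=
  covers_in le (fun _ => True) a b.

Definition is_join_in (T : Type) (le : T -> T -> Prop) (P : T -> Prop)
    (x y z : T) : Prop :=
  [/\ P z, le x z, le y z &
      forall z', P z' -> le x z' -> le y z' -> le z z'].

Definition is_meet_in (T : Type) (le : T -> T -> Prop) (P : T -> Prop)
    (x y z : T) : Prop :=
  [/\ P z, le z x, le z y &
      forall z', P z' -> le z' x -> le z' y -> le z' z].

Definition is_lattice_in (T : Type) (le : T -> T -> Prop) (P : T -> Prop) : Prop :=
  forall x y, P x -> P y ->
    (exists z, is_join_in le P x y z) /\ (exists z, is_meet_in le P x y z).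

Definition upper_semimodular_in (T : Type) (le : T -> T -> Prop)
    (P : T -> Prop) : Prop :=
  forall w g h, covers_in le P w g -> covers_in le P w h -> g <> h ->
    exists x, covers_in le P g x /\ covers_in le P h x.

Definition interval (T : Type) (le : T -> T -> Prop) (u v : T) : T -> Prop :=
  fun w => le u w /\ le w v.

Definition minimal (T : Type) (le : T -> T -> Prop) (a : T) : Prop :=
  forall w, le w a -> w = a.

(* Main.v *)
Require Import Defs.
From HB Require Import structures.
From mathcomp Require Import all_boot.
From mathcomp Require Import ssralg poly ssrnum algC cyclotomic.
From mathcomp Require Import boolp.
From mathcomp Require Import ring zify.

(* Write [v_J] for the [W_J]-component of [v]. Since [(v_K)_J = v_J] for
   [J \subset K], the elements below [v] are the [v_J] with [S(v_J) = J], and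
   they are ordered by inclusion of supports. These supports form an
   antimatroid: the union of [S(v_J) = J] and [S(v_K) = K] is again the support
   of [v_(J :|: K)], and if [v = x u] with [x <> 1] minimal in [x W_S(u)] then
   the last letter [i] of a reduced word of [x] is not in [S(u)], and
   [i |: S(u)] is a support below [v]. Grading, lattices and semimodularity are
   read off the supports.

   The Coxeter-theoretic input is derived from the presentation by letting [W]
   act on two sets. The action on [W * bool] through conjugation gives the
   exchange condition; a reflection representation shows that the map [gen] is
   injective, without which [|S(gen i)| = 1] could fail. *)

Set Implicit Arguments.
Unset Strict Implicit.
Unset Printing Implicit Defensive.

Local Open Scope group_scope.

(** * Actions of a Coxeter group *)

(** The inverse is kept as data so that the permutations of an arbitrary, possibly infinite type
    form a [groupType], to which the universal property of [W] applies. *)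
Record bij (T : Type) := Bij {
  bij_fun :> T -> T;
  bij_inv : T -> T;
  bij_funK : cancel bij_fun bij_inv;
  bij_invK : cancel bij_inv bij_fun }.

Lemma bij_eq (T : Type) (f g : bij T) : f =1 g -> f = g.
Proof.
case: f g => [f f' fK f'K] [g g' gK g'K] /= /funext efg.
subst g.
have ef' : f' = g' by apply/funext => x; rewrite -{1}(g'K x) fK.
by subst g'; congr Bij; apply: Prop_irrelevance.
Qed.

Definition bij1 T : bij T := @Bij T id id (frefl _) (frefl _).
Definition bijM T (f g : bij T) : bij T :=
  Bij (can_comp (bij_funK f) (bij_funK g)) (can_comp (bij_invK g) (bij_invK f)).
Definition bijV T (f : bij T) : bij T := Bij (bij_invK f) (bij_funK f).

Lemma bijMA T : associative (@bijM T).
Proof. by move=> f g h; apply: bij_eq. Qed.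
Lemma bij1M T : left_id (bij1 T) (@bijM T).
Proof. by move=> f; apply: bij_eq. Qed.
Lemma bijM1 T : right_id (bij1 T) (@bijM T).
Proof. by move=> f; apply: bij_eq. Qed.
Lemma bijVM T : left_inverse (bij1 T) (@bijV T) (@bijM T).
Proof. by move=> f; apply: bij_eq => x /=; rewrite bij_funK. Qed.
Lemma bijMV T : right_inverse (bij1 T) (@bijV T) (@bijM T).
Proof. by move=> f; apply: bij_eq => x /=; rewrite bij_invK. Qed.

HB.instance Definition _ T := gen_eqMixin (bij T).
HB.instance Definition _ T := gen_choiceMixin (bij T).
HB.instance Definition _ T := isGroup.Build (bij T)
  (@bijMA T) (@bij1M T) (@bijM1 T) (@bijVM T) (@bijMV T).

Lemma bij_expE T (f : bij T) n x : (f ^+ n) x = iter n f x.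
Proof. by elim: n x => // n IHn x; rewrite expgS /= -IHn. Qed.

(** The relation for [i = j] has exponent 1, so each [f i] is its own inverse and hence a
    permutation; the presentation then extends [f] to [W]. *)
Lemma coxeter_action (W : groupType) (I : finType) (gen : I -> W)
    (m : I -> I -> nat) (T : Type) (f : I -> T -> T) :
  coxeter_system gen m ->
  (forall i j, m i j <> 0%N ->
     forall x, iter (m i j) (fun y => f i (f j y)) x = x) ->
  exists phi : W -> T -> T,
    [/\ forall x, phi 1 x = x,
        forall u v x, phi (u * v) x = phi u (phi v x) &
        forall i x, phi (gen i) x = f i x].
Proof.
move=> [mP _ _ univ] fP.
have fK i : cancel (f i) (f i).
  have [_ [/(_ erefl) mii _]] := mP i i.
  by move=> x; have := fP i i; rewrite mii; apply.
have [i j mij|phi [phiM phi_gen]] := univ (bij T) (fun i => Bij (fK i) (fK i)).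
  by apply: bij_eq => x; rewrite bij_expE -[RHS](fP i j mij x).
exists (fun w => bij_fun (phi w)); split=> [x|u v x|i x]; last by rewrite phi_gen.
  (* [phi] is only known to be multiplicative, but the idempotent [phi 1] of a group must be
     trivial. *)
  have /(mulgI (phi 1)) -> // : phi 1 * phi 1 = phi 1 * 1.
  by rewrite -phiM !mulg1.
by rewrite phiM.
Qed.

(** * A reflection representation and the injectivity of [gen] *)

Section Injectivity.
Import GRing.Theory Num.Theory.
Local Open Scope ring_scope.

(* [u] is a combination of the sequences [z ^+ k] and [z ^- k], each of which
   sums to 0 over a period, unless [z = z^-1 = -1]. *)
Lemma recurrent_sum0 (z : algC) (m : nat) (a : algC) (u : nat -> algC) :
  (1 < m)%N -> m.-primitive_root z -> a ^+ 2 = 2 + z + z^-1 ->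
  (a = 0 -> forall k, u k.+1 = - u k) ->
  (forall k, u k.+2 = (a ^+ 2 - 2) * u k.+1 - u k) ->
  \sum_(k < m) u k = 0.
Proof.
move=> m_gt1 zP a2 u0 uS.
have z0 : z != 0 by apply: contraTneq m_gt1 => z0; move: (prim_expr_order zP);
  rewrite z0 expr0n; case: (m) => //= ? /eqP; rewrite eq_sym oner_eq0.
have sum0 (y : algC) (w : nat -> algC) : y ^+ m = 1 -> y != 1 ->
    (forall k, w k.+1 = y * w k) -> \sum_(k < m) w k = 0.
  move=> ym y1 wS.
  have wE k : w k = y ^+ k * w 0%N.
    by elim: k => [|k IHk]; rewrite ?expr0 ?mul1r // wS IHk exprS mulrA.
  rewrite (eq_bigr (fun k : 'I_m => y ^+ k * w 0%N)) => [|k _]; last exact: wE.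
  rewrite -mulr_suml; have /eqP := subrX1 y m.
  rewrite ym subrr eq_sym mulf_eq0 subr_eq0 (negPf y1) /= => /eqP ->.
  by rewrite mul0r.
have z1 : z != 1.
  by rewrite -[z]expr1 -(prim_order_dvd zP) gtnNdvd.
have [zz|zz] := eqVneq z z^-1.
  have zN1 : z = -1.
    have /eqP : z ^+ 2 = 1 by rewrite expr2 {2}zz divff.
    by rewrite sqrf_eq1 (negPf z1) /= => /eqP.
  (* For [z = -1] one has [a = 0], so [u] is itself geometric of ratio -1. *)
  apply: (sum0 (-1)); rewrite -?zN1 ?(prim_expr_order zP) // => k.
  rewrite zN1 mulN1r; apply: u0; apply/eqP; rewrite -sqrf_eq0 a2 zN1 invrN1.
  by apply/eqP; ring.
have E k : u k = (z - z^-1)^-1 * ((u k.+1 - z^-1 * u k) - (u k.+1 - z * u k)).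
  by field; rewrite z0 /= subr_eq0 -expr2 -subr_eq0;
     apply: contra zz => /eqP h; apply/eqP; apply: (mulfI z0);
     rewrite divff //; apply/eqP; rewrite -subr_eq0 -expr2 h.
rewrite (eq_bigr _ (fun (k : 'I_m) _ => E k)) -mulr_sumr sumrB.
rewrite (sum0 z (fun k => u k.+1 - z^-1 * u k))
  ?(prim_expr_order zP) // => [|k]; last first.
  by rewrite uS a2; field.
rewrite (sum0 z^-1 (fun k => u k.+1 - z * u k)) ?exprVn ?(prim_expr_order zP)
  ?invr1 ?invr_eq1 // => [|k].
  by rewrite subrr mulr0.
by rewrite uS a2; field.
Qed.

(* Dual form of the representation in which [gen i] acts as the reflection with
   Cartan coefficients [c (m i l)]. For a primitive [n]-th root of unity [z] and
   [c n ^+ 2 = 2 + z + z^-1], the product of two reflections has order [n]; the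
   value [c 0], used when [m i l] is infinite, does not matter. *)
Definition reflections (I : finType) (c : nat -> algC) (m : I -> I -> nat)
    (i : I) (x : I -> algC) : I -> algC :=
  fun l => x l - (if i == l then 2 else c (m i l)) * x i.

Lemma coxeter_gen_inj (W : groupType) (I : finType) (gen : I -> W)
    (m : I -> I -> nat) : coxeter_system gen m -> injective gen.
Proof.
move=> cox i j eij; apply/eqP; apply: contraT => neq_ij.
have [n|c cP] := @choice nat algC (fun n a => (1 < n)%N -> exists z : algC,
    n.-primitive_root z /\ a ^+ 2 = 2 + z + z^-1).
  have [n_gt1|_] := boolP (1 < n)%N; last by exists 0.
  have [z zP] := C_prim_root_exists (ltnW n_gt1).
  by exists (sqrtC (2 + z + z^-1)) => _; exists z; rewrite sqrtCK.
have [mP _ _ _] := cox.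
have [k l mkl x|phi [_ _ phi_gen]] := coxeter_action (f := reflections c m) cox.
  have [eqkl|neqkl] := eqVneq k l.
    have [_ [/(_ eqkl) -> _]] := mP k l; rewrite -eqkl; apply/funext => p /=.
    by rewrite /reflections eqxx; ring.
  have [mC [_ /(_ (elimN eqP neqkl)) m1]] := mP k l.
  set n := m k l in mkl m1 mC *; set a := c n.
  have n_gt1 : (1 < n)%N by case: (n) mkl m1 => [|[]].
  have [z [zP]] := cP n n_gt1; rewrite -/a => a2.
  pose g (y : I -> algC) := reflections c m k (reflections c m l y).
  pose X r := iter r g x.
  (* On the coordinates [k] and [l], [g] is a matrix of determinant 1 and trace [a ^+ 2 - 2]; by
     Cayley-Hamilton both coordinates satisfy the recurrence of [recurrent_sum0]. *)
  have Xk r : X r.+1 k = - X r k + a * X r l.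
    by rewrite /X iterS /g /reflections !eqxx eq_sym (negPf neqkl) -mC -/n -/a; ring.
  have Xl r : X r.+1 l = - a * X r k + (a ^+ 2 - 1) * X r l.
    rewrite /X iterS /g /reflections !eqxx [l == k]eq_sym (negPf neqkl) -mC -/n -/a.
    ring.
  have sumk : \sum_(r < n) X r k = 0.
    apply: (recurrent_sum0 (u := X^~ k) n_gt1 zP a2) => [a0 r|r].
      by rewrite Xk a0; ring.
    by rewrite !Xk Xl; ring.
  have suml : \sum_(r < n) X r l = 0.
    apply: (recurrent_sum0 (u := X^~ l) n_gt1 zP a2) => [a0 r|r].
      by rewrite Xl a0; ring.
    by rewrite !Xl Xk; ring.
  apply/funext => p; rewrite -/(X n).
  pose A i p := if i == p then 2 else c (m i p).
  (* Each reflection changes coordinate [p] by a multiple of one coordinate [k] or [l]; hence the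
     total change after [n] rounds is a combination of the two vanishing sums. *)
  have Xp r : X r p = x p - A l p * (\sum_(s < r) X s l)
      - A k p * (\sum_(s < r) X s k - a * \sum_(s < r) X s l).
    elim: r => [|r IHr]; first by rewrite !big_ord0 /X /=; ring.
    rewrite {1}/X iterS -/(X r) /g {1}/reflections -/(A k p).
    rewrite {1}/reflections -/(A l p) IHr /reflections [l == k]eq_sym (negPf neqkl).
    by rewrite -mC -/n -/a !big_ord_recr /=; ring.
  by rewrite Xp sumk suml; ring.
(* On the indicator of [i], the reflection [i] turns coordinate [i] from 1 into -1, while the
   reflection [j] keeps it. *)
have := phi_gen i (fun l => (l == i)%:R); rewrite eij phi_gen => /funeqP /(_ i).
rewrite /reflections !eqxx [j == i]eq_sym (negPf neq_ij) /= mulr0 subr0 mulr1.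
move/eqP; rewrite -subr_eq0; have -> : 1 - (1 - 2) = 2 :> algC by ring.
by rewrite pnatr_eq0.
Qed.

End Injectivity.

(** * Length, exchange and parabolic components *)

Section Coxeter.
Context (W : groupType) (I : finType) (gen : I -> W) (m : I -> I -> nat).
Context (cox : coxeter_system gen m).

Local Notation "''s_' i" := (gen i) (at level 8, i at level 0, format "''s_' i").
Local Notation pw := (prodw gen).

Lemma gen2 i : 's_i * 's_i = 1.
Proof.
have [mP rel _ _] := cox; have [_ [/(_ erefl) mii _]] := mP i i.
by have := rel i i; rewrite mii; apply.
Qed.

Lemma genV i : 's_i^-1 = 's_i.
Proof. by apply: (mulgI 's_i); rewrite mulgV gen2. Qed.

Lemma mulg_genK w i : w * 's_i * 's_i = w.
Proof. by rewrite -mulgA gen2 mulg1. Qed.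

Lemma prodw_cat s t : pw (s ++ t) = pw s * pw t.
Proof. by elim: s => [|i s IHs] /=; rewrite ?mul1g // IHs mulgA. Qed.

Lemma prodw_rcons s i : pw (rcons s i) = pw s * 's_i.
Proof. by rewrite -cats1 prodw_cat /= mulg1. Qed.

Lemma prodw_rev s : pw (rev s) = (pw s)^-1.
Proof.
elim: s => [|i s IHs] /=; first by rewrite invg1.
by rewrite rev_cons prodw_rcons IHs invgM genV.
Qed.

Lemma len_subproof w : exists n, `[< exists2 s, pw s = w & size s = n >].
Proof.
have [_ _ /(_ w) [s ->] _] := cox.
by exists (size s); apply/asboolP; exists s.
Qed.

Definition len w := ex_minn (len_subproof w).

Lemma len_prodw s : len (pw s) <= size s.
Proof. by rewrite /len; case: ex_minnP => n _; apply; apply/asboolP; exists s. Qed.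

Lemma reducedP w s : reduced gen w s <-> pw s = w /\ size s = len w.
Proof.
split=> [[sw s_min]|[sw s_len]]; split=> //.
  rewrite /len; case: ex_minnP => n /asboolP [t tw <-] t_min.
  by apply/eqP; rewrite eqn_leq s_min // t_min //; apply/asboolP; exists s.
by move=> t tw; rewrite s_len -tw len_prodw.
Qed.

Lemma reduced_ex w : exists s, reduced gen w s.
Proof.
suff [s sw sl] : exists2 s, pw s = w & size s = len w.
  by exists s; apply/reducedP.
by rewrite /len; case: ex_minnP => n /asboolP.
Qed.

Lemma len1 : len 1 = 0%N.
Proof. by apply/eqP; rewrite -leqn0 (len_prodw [::]). Qed.

Lemma len_eq0 w : len w = 0%N -> w = 1.
Proof.
by have [s /reducedP [<- <-]] := reduced_ex w; case: s.
Qed.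

Lemma lenM u v : len (u * v) <= len u + len v.
Proof.
have [[s /reducedP [<- <-]] [t /reducedP [<- <-]]] := (reduced_ex u, reduced_ex v).
by rewrite -prodw_cat -size_cat len_prodw.
Qed.

Lemma len_gen_le i : len 's_i <= 1.
Proof. by have := len_prodw [:: i]; rewrite /= mulg1. Qed.

Lemma lenV w : len w^-1 = len w.
Proof.
suff le u : len u^-1 <= len u by apply/eqP; rewrite eqn_leq le -{1}[w]invgK le.
by have [s /reducedP [<- <-]] := reduced_ex u; rewrite -prodw_rev -(size_rev s) len_prodw.
Qed.

(* [eta w t] is the parity of the number of occurrences of the reflection [t]
   among the right inversions read off any word for [w]. *)
Lemma inversion_cocycle : exists eta : W -> W -> bool,
  [/\ forall t, eta 1 t = false,
      forall u v t, eta (u * v) t = eta v t (+) eta u (v * t * v^-1) &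
      forall i t, eta 's_i t = (t == 's_i)].
Proof.
pose f i (x : W * bool) := ('s_i * x.1 * 's_i, x.2 (+) (x.1 == 's_i)).
have [i j mij [t b]|phi [phi1 phiM phi_gen]] := coxeter_action (f := f) cox.
  have [_ /(_ i j mij) rm _ _] := cox.
  set n := m i j in mij rm *; set r := 's_i * 's_j in rm.
  have rV : r^-1 = 's_j * 's_i by rewrite /r invgM !genV.
  have sr k : r ^- k * 's_j = 's_j * r ^+ k.
    elim: k => [|k IHk]; first by rewrite !expg0 invg1 mulg1 mul1g.
    have -> : r ^- k.+1 * 's_j = r ^- k * 's_j * r.
      by rewrite expgS invgM rV /r !mulgA.
    by rewrite IHk -mulgA -expgSr.
  pose c k := t == 's_j * r ^+ k.
  have cS k : (r ^+ k * t * r ^- k == 's_j) = c k.*2.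
    rewrite divg_eq -(inj_eq (mulgI (r ^- k))) mulKg mulgA sr -mulgA -expgnDr addnn.
    by [].
  have cSS k : ('s_j * (r ^+ k * t * r ^- k) * 's_j == 's_i) = c k.*2.+1.
    rewrite -(inj_eq (mulIg 's_j)) -/r mulg_genK -(inj_eq (mulgI 's_j)) mulgA gen2 mul1g.
    rewrite divg_eq -(inj_eq (mulgI (r ^- k))) mulKg !mulgA sr -!mulgA.
    rewrite [X in _ * (_ * X)]mulgA -/r -expgS -expgnDr.
    by rewrite addnS addnn.
  pose F k := \big[addb/false]_(l < k) c l.
  (* The cocycle of [r ^+ k] counts the [l < 2 k] with [t = 's_j * r ^+ l]; for
     [k = n] these come in pairs, as [r ^+ n = 1]. *)
  have itE k : iter k (fun y => f i (f j y)) (t, b) = (r ^+ k * t * r ^- k, b (+) F k.*2).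
    elim: k => [|k IHk]; first by rewrite /F big_ord0 expg0 invg1 mulg1 mul1g addbF.
    rewrite iterS IHk {1}/f {1 2}/f /= cS cSS; congr pair.
      by rewrite expgS invgM rV !mulgA.
    by rewrite /F doubleS !big_ord_recr /= !addbA.
  rewrite itE rm invg1 mulg1 mul1g; congr pair.
  rewrite -addnn /F big_split_ord /= [X in _ (+) (_ (+) X)](eq_bigr (fun l : 'I_n => c l)).
    by rewrite addbb addbF.
  by move=> l _; rewrite /c expgnDr rm mul1g.
(* The Boolean component is only translated, so the value at [false] determines the action and can
   serve as the cocycle. *)
have phiE w t b : phi w (t, b) = (w * t * w^-1, b (+) (phi w (t, false)).2).
  have [s /reducedP [<- _]] := reduced_ex w; elim: s t b => [|i s IHs] t b /=.
    by rewrite !phi1 invg1 mulg1 mul1g addbF.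
  by rewrite !phiM [in LHS]IHs [in RHS]IHs !phi_gen /f /= invgM genV !mulgA addbA.
exists (fun w t => (phi w (t, false)).2); split=> [t|u v t|i t].
- by rewrite phi1.
- by rewrite phiM [phi v _]phiE [phi u _]phiE.
- by rewrite phi_gen.
Qed.

(** An odd count means that [t] does occur among the inversions of the word, and multiplying by [t]
    deletes the corresponding letter. *)
Lemma exchange : exists eta : W -> W -> bool,
  [/\ forall u v t, eta (u * v) t = eta v t (+) eta u (v * t * v^-1),
      forall s t, eta (pw s) t -> exists s',
        [/\ subseq s' s, size s = (size s').+1 & pw s * t = pw s'],
      forall w t, eta w t -> len (w * t) < len w &
      forall w i, eta w 's_i = false -> len w < len (w * 's_i)].
Proof.
have [eta [eta1 etaM eta_gen]] := inversion_cocycle.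
have del s t : eta (pw s) t -> exists s',
    [/\ subseq s' s, size s = (size s').+1 & pw s * t = pw s'].
  elim: s => [|i s IHs] /=; first by rewrite eta1.
  rewrite etaM eta_gen; have [/IHs|_ /=] := boolP (eta (pw s) t).
    move=> [s' [ss' szs st]] _; exists (i :: s'); rewrite /= eqxx szs.
    by split=> //; rewrite -mulgA st.
  rewrite divg_eq => /eqP st; exists s; split=> //; first exact: subseq_cons.
  by rewrite -mulgA st mulgA gen2 mul1g.
have etalen w t : eta w t -> len (w * t) < len w.
  have [s /reducedP [<- sl]] := reduced_ex w => /del [s' [_ ss' ->]].
  by rewrite -sl ss' ltnS len_prodw.
exists eta; split=> // w i ei.
(* By the cocycle rule, passing from [w] to [w * 's_i] flips the parity at ['s_i], so ['s_i]
   shortens [w * 's_i]. *)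
rewrite -{1}[w](mulg_genK w i); apply: etalen.
by rewrite etaM eta_gen eqxx genV gen2 mul1g ei.
Qed.

Lemma len_gen_neq w i : len (w * 's_i) != len w.
Proof.
have [eta [_ _ lt_eta gt_eta]] := exchange.
by have [/lt_eta|/negbTE /gt_eta] := boolP (eta w 's_i);
  rewrite ?neq_ltn => ->; rewrite ?orbT.
Qed.

Lemma len_gen i : len 's_i = 1%N.
Proof.
by have := len_gen_neq 1 i; have := len_gen_le i;
  rewrite mul1g len1; case: (len _) => [|[]].
Qed.

Lemma len_mulg_gen w i :
  (len w < len (w * 's_i) /\ len (w * 's_i) = (len w).+1) \/
  (len (w * 's_i) < len w /\ len w = (len (w * 's_i)).+1).
Proof.
have := len_gen_neq w i; have := lenM w 's_i; have := lenM (w * 's_i) 's_i.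
by rewrite mulg_genK len_gen; lia.
Qed.

Lemma exchange_gen s i : len (pw s * 's_i) < len (pw s) -> exists s',
  [/\ subseq s' s, size s = (size s').+1 & pw s * 's_i = pw s'].
Proof.
have [eta [_ del _ gt_eta]] := exchange.
have [/del //|/negbTE /gt_eta] := boolP (eta (pw s) 's_i).
by move=> h1 h2; have := ltn_trans h1 h2; rewrite ltnn.
Qed.

Lemma reduced_rcons w s i : reduced gen w (rcons s i) ->
  reduced gen (w * 's_i) s /\ len w = (len (w * 's_i)).+1.
Proof.
move=> /reducedP [<-]; rewrite prodw_rcons mulg_genK size_rcons => sl.
have := len_prodw s; have := len_mulg_gen (pw s) i => h1 h2.
by split; [apply/reducedP; split=> //|]; lia.
Qed.

Lemma reduced_subseq s : exists2 s', subseq s' s & reduced gen (pw s) s'.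
Proof.
elim/last_ind: s => [|s i [s' ss' /reducedP [es' ls']]].
  by exists [::] => //; apply/reducedP; rewrite /= len1.
rewrite prodw_rcons; have [[_ lts]|[lts eqs]] := len_mulg_gen (pw s) i.
  exists (rcons s' i); first by rewrite -!cats1 cat_subseq.
  by apply/reducedP; rewrite prodw_rcons es' size_rcons ls' lts.
rewrite -es' in lts; have [s'' [ss'' sz'' es'']] := exchange_gen lts.
exists s''; first by apply: subseq_trans (subseq_trans ss'' ss') (subseq_rcons _ _).
by apply/reducedP; rewrite -es'' es'; split=> //; apply: succn_inj; rewrite -sz'' ls'.
Qed.

(** * Supports, parabolic components and the partial order *)

Section Parabolic.
Implicit Types J K : {set I}.

Local Notation par := (in_parabolic gen).

Lemma par1 J : par J 1. Proof. by exists [::]. Qed.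

Lemma parM J u v : par J u -> par J v -> par J (u * v).
Proof.
move=> [s [sJ ->]] [t [tJ ->]]; exists (s ++ t).
by rewrite all_cat sJ tJ prodw_cat.
Qed.

Lemma parV J u : par J u -> par J u^-1.
Proof. by move=> [s [sJ ->]]; exists (rev s); rewrite all_rev prodw_rev. Qed.

Lemma par_gen J i : i \in J -> par J 's_i.
Proof. by move=> iJ; exists [:: i]; rewrite /= iJ mulg1. Qed.

Lemma par_sub J K u : J \subset K -> par J u -> par K u.
Proof.
move=> /subsetP JK [s [/allP sJ ->]]; exists s; split=> //.
by apply/allP => i /sJ /JK.
Qed.

Lemma par_reduced_ex J u : par J u -> exists2 s, all (mem J) s & reduced gen u s.
Proof.
move=> [s [/allP sJ ->]]; have [s' /mem_subseq ss' rs'] := reduced_subseq s.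
by exists s' => //; apply/allP => i /ss' /sJ.
Qed.

Lemma gen_par J i : par J 's_i -> i \in J.
Proof.
move=> /par_reduced_ex [s sJ /reducedP]; rewrite len_gen.
case: s sJ => [|j [|k s]] /= sJ [e sz] //; move: e sJ.
by rewrite mulg1 andbT => /(coxeter_gen_inj cox) <-.
Qed.

(** Applied to a word of [u] in [J], exchange puts [u * 's_i] in [W_J] for the last letter [i]; thus
    ['s_i] is in [W_J], and injectivity of [gen], through [gen_par], gives [i \in J]. *)
Lemma par_reduced J u s : par J u -> reduced gen u s -> all (mem J) s.
Proof.
elim/last_ind: s u => // s i IHs u uJ /reduced_rcons [rs lu].
suff uiJ : par J (u * 's_i).
  rewrite all_rcons (IHs _ uiJ rs) andbT; apply: gen_par.
  by rewrite -[_ i](mulKg u); apply: parM uiJ; apply: parV.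
have [t /allP tJ /reducedP [et lt]] := par_reduced_ex uJ; subst u.
have [|t' [/mem_subseq tt' _ ->]] := @exchange_gen t i; first by rewrite lu.
by exists t'; split=> //; apply/allP => j /tt' /tJ.
Qed.

Lemma suppP w i : reflect (exists s, reduced gen w s /\ i \in s) (i \in supp gen w).
Proof. by rewrite inE; apply: asboolP. Qed.

Lemma par_supp w : par (supp gen w) w.
Proof.
have [s rs] := reduced_ex w; exists s; split; last by case: rs.
by apply/allP => i si; apply/suppP; exists s.
Qed.

Lemma parE J w : par J w <-> supp gen w \subset J.
Proof.
split=> [wJ|/par_sub]; last by apply; apply: par_supp.
by apply/subsetP => i /suppP [s [rs si]]; apply: (allP (par_reduced wJ rs)).
Qed.

Lemma supp_reduced w s : reduced gen w s -> supp gen w = [set i in s].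
Proof.
move=> rs; apply/eqP; rewrite eqEsubset; apply/andP; split.
  apply/parE; exists s; split; last by case: rs.
  by apply/allP => i; rewrite inE.
by apply/subsetP => i; rewrite inE => si; apply/suppP; exists s.
Qed.

Lemma supp1 : supp gen 1 = set0.
Proof. by apply/eqP; rewrite -subset0; apply/parE/par1. Qed.

Lemma supp0 w : supp gen w = set0 -> w = 1.
Proof.
have [s rs] := reduced_ex w; rewrite (supp_reduced rs) => s0.
by case: rs; case: s s0 => [|i s] // /setP /(_ i); rewrite !inE eqxx.
Qed.

Lemma suppM u v : len (u * v) = (len u + len v)%N ->
  supp gen (u * v) = supp gen u :|: supp gen v.
Proof.
have [[s rs] [t rt]] := (reduced_ex u, reduced_ex v).
rewrite (supp_reduced rs) (supp_reduced rt).
move/reducedP: rs => [<- <-]; move/reducedP: rt => [<- <-] l.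
rewrite (@supp_reduced _ (s ++ t)); first by apply/setP => i; rewrite !inE mem_cat.
by apply/reducedP; rewrite prodw_cat l size_cat.
Qed.

(** Minimality over the whole coset, which makes existence immediate; [in_X] tests single generators
    only, and [in_X_coset_min] identifies the two. *)
Definition coset_min J x := forall z, par J z -> len x <= len (x * z).

Lemma coset_min_ex J w : exists x y, [/\ coset_min J x, par J y & w = x * y].
Proof.
have ex : exists n, `[< exists2 z, par J z & len (w * z) = n >].
  by exists (len (w * 1)); apply/asboolP; exists 1 => //; apply: par1.
case: (ex_minnP ex) => n /asboolP [z zJ <-] zmin.
exists (w * z), z^-1; split; [|exact: parV|by rewrite mulgK].
move=> z' z'J; apply: zmin; apply/asboolP; exists (z * z'); first exact: parM.
by rewrite mulgA.
Qed.

(* If multiplying [x * y] by ['s_i], with [i \in J], shortened it although it does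
   not shorten [y], then [x] would be shortened by an element of [W_J]. *)
Lemma coset_min_len J x y : coset_min J x -> par J y -> len (x * y) = (len x + len y)%N.
Proof.
have [eta [etaM _ lt_eta gt_eta]] := exchange.
move=> xJ /par_reduced_ex [s].
elim/last_ind: s y => [|s i IHs] y; first by move=> _ [<- _]; rewrite len1 mulg1 addn0.
rewrite all_rcons => /andP [iJ sJ] /reduced_rcons [rs ly].
have yE := mulg_genK y i; set y0 := y * 's_i in rs ly yE.
have yJ : par J y0 by exists s; split=> //; case: rs.
have lxy := IHs _ sJ rs.
have lt_x : len (x * y0) < len (x * y0 * 's_i).
  apply: gt_eta; rewrite etaM; apply/negbTE/negP.
  case: (boolP (eta y0 's_i)) => /= [/lt_eta|_ /lt_eta].
    by rewrite yE ly ltnNge leqnSn.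
  rewrite ltnNge xJ //; apply: parM; last exact: parV.
  by apply: parM => //; apply: par_gen.
have := lenM x y; rewrite -[in len (x * y)]yE mulgA ly => le_xy.
by apply/eqP; rewrite eqn_leq le_xy addnS -lxy lt_x.
Qed.

Lemma in_XP J x : in_X gen J x <-> forall i, i \in J -> len x < len (x * 's_i).
Proof.
split=> xJ i iJ.
  have [[a ra] [b rb]] := (reduced_ex x, reduced_ex (x * 's_i)).
  by have := xJ i iJ a b ra rb; case/reducedP: ra => _ ->; case/reducedP: rb => _ ->.
by move=> a b /reducedP [_ ->] /reducedP [_ ->]; apply: xJ.
Qed.

(** If [x = x0 * y] with [x0] minimal and [y <> 1] in [W_J], then by additivity of length the last
    letter of [y] shortens [x]. *)
Lemma in_X_coset_min J x : in_X gen J x <-> coset_min J x.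
Proof.
split=> [/in_XP xJ|xJ]; last first.
  apply/in_XP => i iJ; have := xJ 's_i (par_gen iJ).
  by have := len_gen_neq x i; rewrite leq_eqVlt eq_sym => /negPf ->.
have [x0 [y [x0J yJ xE]]] := coset_min_ex J x.
suff y1 : y = 1 by rewrite xE y1 mulg1.
have [s] := par_reduced_ex yJ; elim/last_ind: s => [_ [] //|s i _].
rewrite all_rcons => /andP [iJ sJ] /reduced_rcons [rs ly].
have yiJ : par J (y * 's_i) by apply: parM => //; apply: par_gen.
by have := xJ i iJ; rewrite xE -mulgA !(coset_min_len x0J) // ltn_add2l ly ltnNge leqnSn.
Qed.

(** The two representatives differ by some [z] in [W_J]; additivity in both directions adds [len z]
    to each length to obtain the other, so [z = 1]. *)
Lemma coset_min_uniq J x y x' y' : coset_min J x -> coset_min J x' ->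
  par J y -> par J y' -> x * y = x' * y' -> y = y'.
Proof.
move=> xJ x'J yJ y'J e.
have zJ : par J (y' * y^-1) by apply: parM => //; apply: parV.
have xE : x = x' * (y' * y^-1) by rewrite mulgA -e mulgK.
have x'E : x' = x * (y' * y^-1)^-1 by rewrite xE mulgK.
have := coset_min_len x'J zJ; have := coset_min_len xJ (parV zJ).
rewrite -xE -x'E lenV => l1 l2.
have /len_eq0 : len (y' * y^-1) = 0%N by lia.
by move/divg1_eq.
Qed.

Lemma proj_subproof J w : exists y, exists x, [/\ coset_min J x, par J y & w = x * y].
Proof. by have [x [y ?]] := coset_min_ex J w; exists y, x. Qed.

Definition proj J w := projT1 (cid (proj_subproof J w)).

Lemma projP J w : exists x, [/\ coset_min J x, par J (proj J w) & w = x * proj J w].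
Proof. by rewrite /proj; case: cid. Qed.

Lemma projE J x y : coset_min J x -> par J y -> proj J (x * y) = y.
Proof.
move=> xJ yJ; have [x' [x'J y'J e]] := projP J (x * y).
by apply/esym; apply: (coset_min_uniq xJ x'J yJ y'J e).
Qed.

Lemma proj_par J w : par J (proj J w). Proof. by have [x []] := projP J w. Qed.

Lemma supp_proj J w : supp gen (proj J w) \subset J.
Proof. by apply/parE/proj_par. Qed.

Lemma proj_id J w : par J w -> proj J w = w.
Proof.
move=> wJ; rewrite -{1}[w]mul1g; apply: projE => // z _.
by rewrite len1.
Qed.

(** If [x] is minimal for [K] and [x'] in [W_K] is minimal for [J], then [x * x'] is minimal for
    [J], because multiplying by [x] adds [len x] throughout [W_K]. *)
Lemma proj_proj J K w : J \subset K -> proj J (proj K w) = proj J w.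
Proof.
move=> JK; have [x [xK yK {2}->]] := projP K w.
have [x' [x'J y'J e]] := projP J (proj K w).
rewrite [in RHS]e mulgA projE // => z zJ.
have x'K : par K x'.
  have -> : x' = proj K w * (proj J (proj K w))^-1 by rewrite {1}e mulgK.
  by apply: parM => //; apply: parV; apply: par_sub y'J.
rewrite -mulgA !(coset_min_len xK) ?leq_add2l //; first exact: x'J.
by apply: parM => //; apply: par_sub zJ.
Qed.

Lemma cox_leP u v : cox_le gen u v <-> proj (supp gen u) v = u.
Proof.
split=> [[x [/in_X_coset_min xJ uJ ->]]|e]; first exact: projE.
have [x [xJ uJ ->]] := projP (supp gen u) v; exists x.
by split; [apply/in_X_coset_min | exact: par_supp | rewrite e].
Qed.

Local Notation "u <=c v" := (cox_le gen u v) (at level 70).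

Lemma proj_le J v : proj J v <=c v.
Proof.
apply/cox_leP; rewrite -(proj_proj v (supp_proj J v)).
exact/proj_id/par_supp.
Qed.

Lemma cox_le_supp u v : u <=c v -> supp gen u \subset supp gen v.
Proof.
move=> [x [/in_X_coset_min xJ uJ ->]].
by rewrite suppM ?(coset_min_len xJ) // subsetUr.
Qed.

Lemma cox_le_trans u v w : u <=c v -> v <=c w -> u <=c w.
Proof.
move=> uv /cox_leP vw; apply/cox_leP; move/cox_leP: (uv) => {2}<-.
by rewrite -[in RHS]vw proj_proj // cox_le_supp.
Qed.

Lemma cox_le_below u v w : u <=c w -> v <=c w ->
  supp gen u \subset supp gen v -> u <=c v.
Proof.
move=> /cox_leP uw /cox_leP vw uv; apply/cox_leP.
by rewrite -vw proj_proj.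
Qed.

Lemma cox_le_eq u v w : u <=c w -> v <=c w -> supp gen u = supp gen v -> u = v.
Proof. by move=> /cox_leP uw /cox_leP vw e; rewrite -uw e. Qed.

Lemma cox_le_refl u : u <=c u.
Proof. exact/cox_leP/proj_id/par_supp. Qed.

Lemma cox_le1 u : 1 <=c u.
Proof. by apply/cox_leP/supp0/eqP; rewrite -subset0 -supp1 supp_proj. Qed.

(** The component of [w] along the union lies above [u] and [v] by [proj_proj], so its support fills
    the union. *)
Lemma cox_le_join u v w : u <=c w -> v <=c w -> exists x,
  [/\ x <=c w, u <=c x, v <=c x & supp gen x = supp gen u :|: supp gen v].
Proof.
move=> uw vw; set K := _ :|: _; exists (proj K w).
have below y : y <=c w -> supp gen y \subset K -> y <=c proj K w.
  by move=> /cox_leP yw yK; apply/cox_leP; rewrite proj_proj.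
have ux := below u uw (subsetUl _ _); have vx := below v vw (subsetUr _ _).
split=> //; first exact: proj_le.
by apply/eqP; rewrite eqEsubset supp_proj subUset !cox_le_supp.
Qed.

Lemma cox_le_step u v : u <=c v -> u <> v -> exists2 i, i \notin supp gen u &
  exists w, [/\ u <=c w, w <=c v & supp gen w = i |: supp gen u].
Proof.
move=> uv nuv; have [x [/in_X_coset_min xJ uJ vE]] := uv.
have [s rs] := reduced_ex x.
have : s != [::].
  apply/eqP => s0; apply: nuv; rewrite vE.
  by case: rs => <- _; rewrite s0 /= mul1g.
elim/last_ind: s rs => // s i _ /reduced_rcons [_ lx] _.
have iu : i \notin supp gen u.
  by apply/negP => /par_gen /xJ; rewrite lx ltnn.
exists i => //; set K := i |: _; exists (proj K v).
have uK : supp gen u \subset K by apply: subsetUr.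
have uw : u <=c proj K v by apply/cox_leP; rewrite proj_proj //; apply/cox_leP.
split=> //; first exact: proj_le.
apply/eqP; rewrite eqEsubset supp_proj /= subUset cox_le_supp // andbT sub1set.
have [x' [x'K siK xE]] := projP K x.
(* The [K]-component of [v] is thus [proj K x * u]. Lengths add in this product, so it suffices to
   find [i] in the support of [proj K x]. *)
have e : v = x' * (proj K x * u) by rewrite vE {1}xE mulgA.
have ukpar : par K u by apply: par_sub uJ.
rewrite e projE //; last exact: parM.
have xu z : par (supp gen u) z -> len (proj K x * z) = (len (proj K x) + len z)%N.
  move=> zJ; apply/eqP; rewrite -(eqn_add2l (len x')) addnA.
  rewrite -!(coset_min_len x'K) // -?xE; last by apply: parM => //; apply: par_sub zJ.
  by rewrite mulgA -xE (coset_min_len xJ).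
rewrite suppM ?xu // inE; apply/orP; left.
(* Since ['s_i] lies in [W_K] and shortens [x], it shortens the [K]-component of [x]; exchange then
   gives a reduced word ending in [i]. *)
have : len (proj K x * 's_i) < len (proj K x).
  rewrite -(ltn_add2l (len x')) -!(coset_min_len x'K) // -?xE; last first.
    by apply: parM => //; apply: par_gen; rewrite !inE eqxx.
  by rewrite mulgA -xE lx.
move=> lt; have [t rt] := reduced_ex (proj K x).
have [et lt'] := iffLR (reducedP _ _) rt.
rewrite -et in lt; have [t' [tt' sz e']] := exchange_gen lt.
have rt' : reduced gen (proj K x) (rcons t' i).
  by apply/reducedP; rewrite prodw_rcons -e' mulg_genK size_rcons -sz et.
by rewrite (supp_reduced rt') inE mem_rcons inE eqxx.
Qed.

End Parabolic.
End Coxeter.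

(** * Intervals *)

Section Intervals.
Context (W : groupType) (I : finType) (gen : I -> W) (m : I -> I -> nat).
Context (cox : coxeter_system gen m).

Local Notation "u <=c v" := (cox_le gen u v) (at level 70).
Local Notation supp := (supp gen).

(** The convexity assumption on [P] lets the step of [cox_le_step] stay inside [P], for the whole
    poset and for intervals alike. *)
Lemma covers_in_supp (P : W -> Prop) u v :
  (forall w, u <=c w -> w <=c v -> P w) ->
  covers_in (cox_le gen) P u v -> exists2 i, i \notin supp u & supp v = i |: supp u.
Proof.
move=> Pw [_ _ uv nuv cov]; have [i iu [w [uw wv wE]]] := cox_le_step cox uv nuv.
exists i => //; have [wu|<- //] := cov w (Pw w uw wv) uw wv.
by move: iu; rewrite -wu wE !inE eqxx.
Qed.

Lemma covers_in_card (P : W -> Prop) u v :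
  P u -> P v -> u <=c v -> #|supp v| = #|supp u|.+1 ->
  covers_in (cox_le gen) P u v.
Proof.
move=> Pu Pv uv card_v; split=> // [uv_eq|w _ uw wv].
  by have := n_Sn #|supp u|; rewrite -card_v uv_eq.
have su := cox_le_supp cox uw; have sv := cox_le_supp cox wv.
have [le_wu|lt_uw] := leqP #|supp w| #|supp u|.
  left; apply: (cox_le_eq cox wv uv); apply/esym/eqP.
  by rewrite eqEcard su.
right; apply: (cox_le_eq cox wv (cox_le_refl cox v)); apply/eqP.
by rewrite eqEcard sv card_v.
Qed.

Lemma interval_joinP u v x y z :
  interval (cox_le gen) u v x -> interval (cox_le gen) u v y ->
  [/\ z <=c v, x <=c z, y <=c z & supp z = supp x :|: supp y] ->
  is_join_in (cox_le gen) (interval (cox_le gen) u v) x y z.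
Proof.
move=> [ux xv] [uy yv] [zv xz yz zE]; split=> //.
  by split=> //; exact: (cox_le_trans cox ux xz).
move=> z' [_ z'v] xz' yz'; apply: (cox_le_below cox zv z'v).
by rewrite zE subUset !(cox_le_supp cox).
Qed.

Lemma interval_lattice u v : is_lattice_in (cox_le gen) (interval (cox_le gen) u v).
Proof.
move=> x y Px Py; have [[ux xv] [uy yv]] := (Px, Py); split.
  have [z zP] := cox_le_join cox xv yv; exists z; exact: interval_joinP zP.
pose lb w := [/\ u <=c w, w <=c x & w <=c y].
have uv : u <=c v by exact: (cox_le_trans cox ux xv).
have ex : exists n, `[< exists2 w, lb w & #|supp w| = n >].
  by exists #|supp u|; apply/asboolP; exists u => //; split=> //; apply: cox_le_refl cox _.
have bound n : `[< exists2 w, lb w & #|supp w| = n >] -> n <= #|I|.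
  by move=> /asboolP [w _ <-]; apply: max_card.
(* The meet is a common lower bound [w] of largest support: its join with any other one is again a
   common lower bound, hence equals [w]. *)
case: (ex_maxnP ex bound) => n /asboolP [w [uw wx wy] <-] wmax.
exists w; split=> //; first by split=> //; exact: (cox_le_trans cox wx xv).
move=> w' [uw' w'v] w'x w'y.
have wv := cox_le_trans cox wx xv.
have [z [zv wz w'z zE]] := cox_le_join cox wv w'v.
have zx : z <=c x.
  by apply: (cox_le_below cox zv xv); rewrite zE subUset !(cox_le_supp cox).
have zy : z <=c y.
  by apply: (cox_le_below cox zv yv); rewrite zE subUset !(cox_le_supp cox).
suff -> : w = z by [].
apply: (cox_le_eq cox wv zv); apply/eqP; rewrite eqEcard (cox_le_supp cox wz) /=.
by apply: wmax; apply/asboolP; exists z => //; split=> //; exact: (cox_le_trans cox uw wz).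
Qed.

(** The covers [g] and [h] add distinct letters to the support of [w], so their join has exactly one
    letter more than each. *)
Lemma interval_semimodular u v :
  upper_semimodular_in (cox_le gen) (interval (cox_le gen) u v).
Proof.
move=> w g h wg wh ngh.
have [Pw Pg _ _ _] := wg; have [_ Ph _ _ _] := wh.
have [[[uw wv] [ug gv]] [uh hv]] := (Pw, Pg, Ph).
have sub x : x <=c v -> forall c, w <=c c -> c <=c x -> interval (cox_le gen) u v c.
  by move=> xv c wc cx; split;
    [exact: (cox_le_trans cox uw wc)|exact: (cox_le_trans cox cx xv)].
have [i iw gE] := covers_in_supp (sub g gv) wg.
have [j jw hE] := covers_in_supp (sub h hv) wh.
have nij : i != j.
  by apply/eqP => ij; apply: ngh; apply: (cox_le_eq cox gv hv); rewrite gE hE ij.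
have [x [xv gx hx xE]] := cox_le_join cox gv hv.
have Px : interval (cox_le gen) u v x by split=> //; exact: (cox_le_trans cox ug gx).
have xE' : supp x = i |: (j |: supp w).
  by rewrite xE gE hE setUACA setUid -setUA.
have card_x : #|supp x| = #|supp w|.+2.
  by rewrite xE' !cardsU1 in_setU1 (negPf nij) (negPf iw) jw.
exists x; split; apply: covers_in_card => //; rewrite card_x.
  by rewrite gE cardsU1 iw.
by rewrite hE cardsU1 jw.
Qed.

End Intervals.

Theorem theorem1 (W : groupType) (I : finType) (gen : I -> W)
    (m : I -> I -> nat) :
  coxeter_system gen m ->
  (* (1) graded with rank function w |-> |S(w)| *)
  ([/\ minimal (cox_le gen) 1,
       (forall a : W, minimal (cox_le gen) a -> a = 1),
       #|supp gen 1| = 0%N &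
       (forall u v : W, covers (cox_le gen) u v ->
          #|supp gen v| = (#|supp gen u| + 1)%N)]) /\
  (* (2) intervals are upper semimodular lattices *)
  (forall u v : W, cox_le gen u v ->
     is_lattice_in (cox_le gen) (interval (cox_le gen) u v) /\
     upper_semimodular_in (cox_le gen) (interval (cox_le gen) u v)).
Proof.
move=> cox; split; last first.
  by move=> u v _; split;
    [exact: (interval_lattice cox)|exact: (interval_semimodular cox)].
split=> [w w1|a a_min||u v uv].
- by apply/(supp0 cox)/eqP; rewrite -subset0 -(supp1 cox) (cox_le_supp cox w1).
- by apply/esym/a_min/(cox_le1 cox).
- by rewrite (supp1 cox) cards0.
- have [i iu ->] := covers_in_supp cox (fun _ _ _ => Logic.I) uv.
  by rewrite cardsU1 iu addn1.
Qed.
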